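(* Let $d\in\mathbb{N}$, $0<s,p<\infty$ with $sp\neq d$ (no restriction $s<1$). Let $\mathbb{Z}_+=\{0,1,2,\ldots\}$ and $\|x\|_\infty=\max_i|x_i|$. Then: \begin{enumerate} \item If $sp<d$ and $d-sp\ge\delta>0$, there is a constant $c=c(s,p,\delta)<\infty$ such that \[\sum_{j\in\mathbb{Z}_+^d\setminus\{0\}}\frac{|u(j)|^p}{\|j\|_\infty^{sp}}\le c\sum_{j\in\mathbb{Z}_+^d\setminus\{0\}}\ \sum_{\substack{m\in\mathbb{Z}_+^d\setminus\{0\}\\ m\ne j}}\frac{|u(j)-u(m)|^p}{\|j-m\|_\infty^{sp+d}}\] for all $u:\mathbb{Z}_+^d\to\mathbb{C}$ for which the left side is finite. \item If $sp=d$ and $\varepsilon>0$, there is a constant $c=c(d,s,p,\varepsilon)<\infty$ such that \[\sum_{j\in\mathbb{Z}_+^d\setminus\{0\}}\frac{|u(j)|^p}{\|j\|_\infty^{sp+\varepsilon}}\le c\sum_{j\in\mathbb{Z}_+^d}\ \sum_{\substack{m\in\mathbb{Z}_+^d\\ m\ne j}}\frac{|u(j)-u(m)|^p}{\|j-m\|_\infty^{sp+d+\varepsilon}}\le c\sum_{j\in\mathbb{Z}_+^d}\ \sum_{\substack{m\in\mathbb{Z}_+^d\\ m\ne j}}\frac{|u(j)-u(m)|^p}{\|j-m\|_\infty^{sp+d}}\] for all $u:\mathbb{Z}_+^d\to\mathbb{C}$ with $u(0)=0$. \item If $sp>d$, there is a constant $c=c(d,s,p)<\infty$ such that \[\sum_{j\in\mathbb{Z}_+^d\setminus\{0\}}\frac{|u(j)|^p}{\|j\|_\infty^{sp}}\le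 c\sum_{j\in\mathbb{Z}_+^d}\ \sum_{\substack{m\in\mathbb{Z}_+^d\\ m\ne j}}\frac{|u(j)-u(m)|^p}{\|j-m\|_\infty^{sp+d}}\] for all $u:\mathbb{Z}_+^d\to\mathbb{C}$ with $u(0)=0$. \item All three statements above also hold with $\mathbb{Z}_+^d$ replaced by $\mathbb{Z}^d$ throughout (with possibly bigger constants). \end{enumerate} *)

(* Defs.v *)
From HB Require Import structures.
From mathcomp Require Import all_boot all_order all_algebra.
From mathcomp Require Import all_classical all_reals all_analysis.
From mathcomp Require Import complex.
Unset Printing Implicit Defensive.
Import Order.TTheory GRing.Theory Num.Theory.
Local Open Scope classical_set_scope.
Local Open Scope ring_scope.

Definition lat (d : nat) := {ffun 'I_d -> int}.

Definition lat0 (d : nat) : lat d := [ffun _ => 0%R].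

Definition latsub (d : nat) (j m : lat d) : lat d := [ffun i => j i - m i].
Arguments latsub {d} j m.

Definition supn (d : nat) (j : lat d) : nat := \max_(i < d) `|j i|%N.
Arguments supn {d} j.

Definition Zplus (d : nat) : set (lat d) := [set j | forall i, (0 <= j i)%R].

Definition dom (d : nat) (full : bool) : set (lat d) :=
  if full then setT else Zplus d.

Notation cabs z := (Normc.normc z).

Definition hardyL (R : realType) (d : nat) (A : set (lat d))
    (u : lat d -> R[i]) (p a : R) : \bar R :=
  \esum_(j in A `\ lat0 d) ((cabs (u j) `^ p) / ((supn j)%:R `^ a))%:E.

Definition hardyR (R : realType) (d : nat) (B : set (lat d))
    (u : lat d -> R[i]) (p b : R) : \bar R :=
  \esum_(j in B) \esum_(m in B `\ j)
     ((cabs (u j - u m) `^ p) / ((supn (latsub j m))%:R `^ b))%:E.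
Arguments hardyL {R d} A u p a.
Arguments hardyR {R d} B u p b.

(* Main.v *)
(* Fix an integer b and split the lattice into the shells T_0 = {0} and
   T_k = {b^(k-1) <= |j| < b^k}.  Averaging
   |u(j)|^p <= 2^p (|u(j) - u(m)|^p + |u(m)|^p) over m in a neighbouring shell
   T_l and summing over j in T_k, the differences are controlled by the right
   side, because |j - m|^d is at most a constant times the size of T_l.  With
   X = sum_k b^(-ka) sum_(T_k) |u|^p, comparable to the left side, what remains
   is at most theta X, where theta is of order b^(a-d) for l = k+1 and of order
   b^(d-a) for l = k-1.  So one goes up when a < d and down to u(0) = 0 when
   a > d, and a large b allows the remainder to be absorbed; for a < d it only
   depends on d - a, because |T_k| / |T_(k+1)| <= 2 b^(-d) in every dimension.
   The critical case sp = d is the case a = sp + eps > d. *)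
Require Import Defs.
From HB Require Import structures.
From mathcomp Require Import all_boot all_order all_algebra.
From mathcomp Require Import all_classical all_reals all_analysis.
From mathcomp Require Import complex zify ring lra.
Import Order.TTheory GRing.Theory Num.Theory.
Local Open Scope classical_set_scope.
Local Open Scope ring_scope.

Set Implicit Arguments.
Unset Strict Implicit.

(** * Sup norm and balls of the lattice *)

Lemma supn_leP (d : nat) (j : lat d) (n : nat) :
  reflect (forall i, (`|j i| <= n)%N) (supn j <= n)%N.
Proof.
apply: (iffP (bigmax_leqP _ _ _)) => [h i|h i _]; first exact: h.
exact: h.
Qed.

Lemma leq_supn (d : nat) (j : lat d) (i : 'I_d) : (`|j i| <= supn j)%N.
Proof. by move/supn_leP: (leqnn (supn j)). Qed.

Lemma supn_gt0 (d : nat) (j : lat d) : (0 < supn j)%N = (j != lat0 d).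
Proof.
rewrite lt0n; congr (~~ _); apply/eqP/eqP => [j0|->].
  apply/ffunP => i; rewrite ffunE; apply/eqP; rewrite -absz_eq0 -leqn0 -j0.
  exact: leq_supn.
by apply/eqP; rewrite -leqn0; apply/supn_leP => i; rewrite ffunE.
Qed.

Lemma supn_latsub_gt0 (d : nat) (j m : lat d) :
  (0 < supn (latsub j m))%N = (m != j).
Proof.
rewrite supn_gt0; congr (~~ _); apply/eqP/eqP => [/ffunP h|->].
  by apply/ffunP => i; apply/esym/subr0_eq; have := h i; rewrite !ffunE.
by apply/ffunP => i; rewrite !ffunE subrr.
Qed.

(* One less than the side length of the set of points of norm at most [n]. *)
Definition width (full : bool) (n : nat) : nat := if full then n.*2 else n.

(** Points are coded by finite functions, shifted by [n] in the full lattice, so that the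
    cardinality is a count of functions. *)
Definition ball (d : nat) (full : bool) (n : nat) : seq (lat d) :=
  [seq ([ffun i => (nat_of_ord (f i))%:Z - (if full then n else 0%N)%:Z] : lat d)
     | f : {ffun 'I_d -> 'I_(width full n).+1}].

Lemma ball_uniq (d : nat) (full : bool) (n : nat) : uniq (ball d full n).
Proof.
rewrite map_inj_uniq ?enum_uniq// => f g /ffunP fg; apply/ffunP => i.
apply/val_inj; have := fg i; rewrite !ffunE => /addIr; by case.
Qed.

Lemma size_ball (d : nat) (full : bool) (n : nat) :
  size (ball d full n) = ((width full n).+1 ^ d)%N.
Proof. by rewrite size_map -cardE card_ffun !card_ord. Qed.

Lemma mem_ball (d : nat) (full : bool) (n : nat) (j : lat d) :
  j \in ball d full n <-> dom d full j /\ (supn j <= n)%N.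
Proof.
split.
  case/mapP => f _ ->; split.
    by case: full f => f //= i; rewrite ffunE subr0.
  apply/supn_leP => i; rewrite ffunE.
  by rewrite /width; case: full f => f; case: (f i) => x /=; lia.
case=> jD /supn_leP jn; apply/mapP.
(* The witness undoes the shift; the bound on the norm keeps each coordinate in the range where
   [inord] is faithful. *)
exists [ffun i => inord (absz (j i + (if full then n else 0%N)%:Z)%R)].
  by rewrite mem_enum.
apply/ffunP => i; rewrite !ffunE inordK.
  by move: jD (jn i); case: full => [_|/(_ i)]; move: (j i) => x; lia.
by move: jD (jn i); rewrite /width; case: full => [_|/(_ i)];
  move: (j i) => x; lia.
Qed.

Lemma ball_dist (d : nat) (full : bool) (n : nat) (j m : lat d) :
  j \in ball d full n -> m \in ball d full n ->
  (supn (latsub j m) <= width full n)%N.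
Proof.
move=> /mem_ball[jD /supn_leP jn] /mem_ball[mD /supn_leP mn].
apply/supn_leP => i; rewrite ffunE; move: jD mD (jn i) (mn i).
by rewrite /width; case: full => [_ _|/(_ i) + /(_ i)];
  move: (j i) (m i) => x y; lia.
Qed.

(** * Shells and their cardinalities *)

(** Balls are closed, so the strict bound |j| < b^k becomes the radius b^k - 1. For k = 0 this
    radius is 0, which leaves only the origin. *)
Definition shell (d : nat) (full : bool) (b k : nat) : seq (lat d) :=
  [seq j <- ball d full (b ^ k).-1 | (k == 0%N) || (b ^ k.-1 <= supn j)%N].

(** Cardinality of the ball from which the k-th shell is cut out. *)
Definition vol (d : nat) (full : bool) (b k : nat) : nat :=
  ((width full (b ^ k).-1).+1 ^ d)%N.

Lemma shell_uniq (d : nat) (full : bool) (b k : nat) :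
  uniq (shell d full b k).
Proof. exact/filter_uniq/ball_uniq. Qed.

Lemma shell_ball (d : nat) (full : bool) (b k : nat) (j : lat d) :
  j \in shell d full b k -> j \in ball d full (b ^ k).-1.
Proof. by rewrite mem_filter => /andP[]. Qed.

Lemma ball_sub (d : nat) (full : bool) (n n' : nat) (j : lat d) :
  (n <= n')%N -> j \in ball d full n -> j \in ball d full n'.
Proof.
move=> nn' /mem_ball[jD jn]; apply/mem_ball; split=> //.
exact: leq_trans nn'.
Qed.

Lemma shell0 (d : nat) (full : bool) (b : nat) (j : lat d) :
  j \in shell d full b 0 -> j = lat0 d.
Proof.
move/shell_ball/mem_ball => [_]; rewrite expn0 leqNgt supn_gt0.
by move/negPn/eqP.
Qed.

Lemma mem_shellS (d : nat) (full : bool) (b k : nat) (j : lat d) :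
  (0 < b)%N ->
  j \in shell d full b k.+1 <->
  dom d full j /\ (b ^ k <= supn j < b ^ k.+1)%N.
Proof.
move=> b0; have bk : (0 < b ^ k.+1)%N by rewrite expn_gt0 b0.
rewrite mem_filter /=; split.
  by case/andP=> -> /mem_ball[jD jn]; split=> //=; lia.
by case=> jD /andP[-> jn] /=; apply/mem_ball; split => //; lia.
Qed.

Lemma shellS_neq0 (d : nat) (full : bool) (b k : nat) (j : lat d) :
  (0 < b)%N -> j \in shell d full b k.+1 -> j != lat0 d.
Proof.
move=> b0 /mem_shellS -/(_ b0) [_ /andP[bj _]].
by rewrite -supn_gt0; apply: leq_trans bj; rewrite expn_gt0 b0.
Qed.

(** Recovers the index of a shell from any of its points. This gives disjointness of the shells and
    lets the target shell be chosen as a function of the point. *)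
Definition level (d b : nat) (j : lat d) : nat :=
  if supn j == 0%N then 0%N else (trunc_log b (supn j)).+1.

Lemma shell_level (d : nat) (full : bool) (b k : nat) (j : lat d) :
  (1 < b)%N -> j \in shell d full b k -> level b j = k.
Proof.
move=> b1; case: k => [/shell0 ->|k jk].
  by rewrite /level -leqn0 leqNgt supn_gt0 eqxx.
have j0 := shellS_neq0 (ltnW b1) jk.
case/mem_shellS: jk => [|_ jk]; first exact: ltnW.
by rewrite /level eqn0Ngt supn_gt0 j0 /= (trunc_log_eq b1 jk).
Qed.

Lemma shell_cover (d : nat) (full : bool) (b K : nat) (j : lat d) :
  (0 < b)%N -> dom d full j -> j != lat0 d -> (supn j < b ^ K)%N ->
  exists2 k, (0 < k <= K)%N & j \in shell d full b k.
Proof.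
move=> b0 jD j0; elim: K => [|K IH] jK.
  by move: jK; rewrite expn0 ltnNge supn_gt0 j0.
case: (ltnP (supn j) (b ^ K)) => jK'.
  by have [k /andP[k0 kK] jk] := IH jK'; exists k => //; rewrite k0 ltnW.
by exists K.+1; rewrite ?leqnn//; apply/mem_shellS => //; rewrite jK'.
Qed.

(** The side of the ball is b^k in the orthant and 2 b^k - 1 in the full lattice, and b (2 b^k - 1)
    <= 2 b^(k+1) - 1. *)
Lemma vol_lb (d : nat) (full : bool) (b k : nat) : (0 < b)%N ->
  (b ^ d * vol d full b k <= vol d full b k.+1)%N.
Proof.
move=> b0; rewrite /vol -expnMn; have [->//|d0] := posnP d.
have bk : (0 < b ^ k)%N by rewrite expn_gt0 b0.
rewrite leq_exp2r// expnS /width; case: full; nia.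
Qed.

Lemma vol_ub (d : nat) (full : bool) (b k : nat) : (0 < b)%N ->
  (vol d full b k.+1 <= (2 * b) ^ d * vol d full b k)%N.
Proof.
move=> b0; rewrite /vol -expnMn; have [->//|d0] := posnP d.
have bk : (0 < b ^ k)%N by rewrite expn_gt0 b0.
rewrite leq_exp2r// expnS /width; case: full; nia.
Qed.

Lemma size_shell_ub (d : nat) (full : bool) (b k : nat) :
  (size (shell d full b k) <= vol d full b k)%N.
Proof. by rewrite /vol -size_ball size_filter count_size. Qed.

(** What a shell omits from its ball lies in the preceding ball, which holds at most a fraction
    b^(-d) <= 1/2 of the points. *)
Lemma size_shell_lb (d : nat) (full : bool) (b k : nat) :
  (0 < d)%N -> (1 < b)%N ->
  (vol d full b k <= 2 * size (shell d full b k))%N.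
Proof.
move=> d0 b1; have b0 := ltnW b1; case: k => [|k].
  by rewrite size_filter (eq_count (a2 := predT))// count_predT size_ball /vol; lia.
have le_compl : (count (predC (fun j => b ^ k <= supn j)%N)
    (ball d full (b ^ k.+1).-1) <= vol d full b k)%N.
  rewrite -size_filter /vol -size_ball; apply: uniq_leq_size.
    exact/filter_uniq/ball_uniq.
  move=> j; rewrite mem_filter /= -ltnNge => /andP[jk /mem_ball[jD _]].
  by apply/mem_ball; split => //; lia.
have := count_predC (fun j => b ^ k <= supn j)%N (ball d full (b ^ k.+1).-1).
rewrite size_ball -/(vol d full b k.+1) size_filter /=.
have := vol_lb d full k b0.
have : (b ^ 1 <= b ^ d)%N by rewrite leq_pexp2l.
rewrite expn1; nia.
Qed.

(** The index starts at 1 because the left side omits the origin. *)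
Definition shells (d : nat) (full : bool) (b K : nat) : seq (lat d) :=
  flatten [seq shell d full b k | k <- index_iota 1 K.+1].

Lemma mem_shells (d : nat) (full : bool) (b K : nat) (j : lat d) :
  reflect (exists2 k, (0 < k <= K)%N & j \in shell d full b k)
    (j \in shells d full b K).
Proof.
apply: (iffP flattenP) => [[_ /mapP[k + ->] jk]|[k k0K jk]].
  by rewrite mem_index_iota ltnS; exists k.
by exists (shell d full b k) => //; apply: map_f; rewrite mem_index_iota ltnS.
Qed.

Lemma shells_uniq (d : nat) (full : bool) (b K : nat) :
  (1 < b)%N -> uniq (shells d full b K).
Proof.
move=> b1; rewrite /shells; have := iota_uniq 1 (K.+1 - 1).
rewrite -/(index_iota 1 K.+1); elim: (index_iota _ _) => //= k s IH /andP[ks us].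
rewrite cat_uniq shell_uniq IH// andbT; apply/hasPn => j.
move=> /flattenP[_ /mapP[l ls ->] jl]; apply/negP => jk.
by move: ks; rewrite -(shell_level b1 jk) (shell_level b1 jl) ls.
Qed.

(** * Finite sums and extended sums *)

Lemma sum_le_esum (R : realType) (T : choiceType) (S : set T)
    (a : T -> \bar R) (s : seq T) :
  uniq s -> (forall x, x \in s -> S x) ->
  (\sum_(x <- s) a x <= \esum_(x in S) a x)%E.
Proof.
move=> us sS; apply: esum_ge; exists [set` s]; last by rewrite -fsbig_seq.
by split => [|x /= /sS].
Qed.

Lemma esum_le_sum (R : realType) (T : choiceType) (S : set T)
    (a : T -> \bar R) (c : \bar R) :
  (forall s : seq T, uniq s -> (forall x, x \in s -> S x) ->
     (\sum_(x <- s) a x <= c)%E) ->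
  (\esum_(x in S) a x <= c)%E.
Proof.
move=> h; apply: ge_ereal_sup => _ [F [finF FS] <-].
rewrite fsbig_finite//; apply: h; first exact: finmap.fset_uniq.
by move=> x; rewrite in_fset_set// inE => /FS.
Qed.

Lemma ler_sum_uniq_sub (R : numDomainType) (T : eqType) (s t : seq T)
    (g : T -> R) :
  uniq s -> uniq t -> {subset s <= t} -> (forall x, 0 <= g x) ->
  \sum_(x <- s) g x <= \sum_(x <- t) g x.
Proof.
move=> us ut st g0.
have st' : perm_eq s [seq x <- t | x \in s].
  apply: uniq_perm => //; first exact: filter_uniq.
  by move=> x; rewrite mem_filter; case: (boolP (x \in s)) => // /st ->.
rewrite (perm_big _ st') big_filter big_mkcond /=.
by apply: ler_sum => x _; case: ifP.
Qed.

Lemma big_shells (R : numDomainType) (d : nat) (full : bool) (b K : nat)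
    (g : lat d -> R) :
  \sum_(j <- shells d full b K) g j =
  \sum_(1 <= k < K.+1) \sum_(j <- shell d full b k) g j.
Proof. by rewrite /shells big_flatten big_map. Qed.

(** * Pointwise and averaging inequalities *)

Lemma cabs_ge0 (R : realType) (z : R[i]) : 0 <= cabs z.
Proof. by case: z => x y; rewrite sqrtr_ge0. Qed.

(** The sum in the triangle inequality is bounded by twice the maximum. Unlike convexity, this also
    covers p < 1. *)
Lemma powR_cabs_le (R : realType) (p : R) (x y : R[i]) : 0 <= p ->
  cabs x `^ p <= 2 `^ p * (cabs (x - y) `^ p + cabs y `^ p).
Proof.
move=> p0.
have tri : cabs x <= cabs (x - y) + cabs y.
  by rewrite -{1}(subrK y x); exact: le_normcD.
have mx0 : 0 <= Num.max (cabs (x - y)) (cabs y).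
  by rewrite le_max cabs_ge0.
have xle : cabs x <= 2 * Num.max (cabs (x - y)) (cabs y).
  apply: (le_trans tri); rewrite mulr_natl mulr2n.
  by apply: lerD; rewrite le_max lexx ?orbT.
apply: (@le_trans _ _ ((2 * Num.max (cabs (x - y)) (cabs y)) `^ p)).
  by apply: ge0_ler_powR; rewrite ?nnegrE ?cabs_ge0 ?mulr_ge0.
rewrite powRM//; apply: ler_wpM2l; first exact: powR_ge0.
by rewrite maxEle; case: ifP => _; rewrite ?lerDl ?lerDr ?powR_ge0.
Qed.

Lemma sum_average (R : numDomainType) (I : eqType) (S T : seq I)
    (v : I -> R) (f : I -> I -> R) (c : R) :
  (forall j m, v j <= c * (f j m + v m)) ->
  (size T)%:R * (\sum_(j <- S) v j) <=
  c * (\sum_(j <- S) \sum_(m <- T) f j m + (size S)%:R * \sum_(m <- T) v m).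
Proof.
move=> h.
have -> : (size T)%:R * (\sum_(j <- S) v j) = \sum_(j <- S) \sum_(m <- T) v j.
  rewrite mulr_sumr; apply: eq_bigr => j _.
  by rewrite big_const_seq count_predT iter_addr_0 mulr_natl.
have -> : (size S)%:R * (\sum_(m <- T) v m) = \sum_(j <- S) \sum_(m <- T) v m.
  by rewrite big_const_seq count_predT iter_addr_0 mulr_natl.
rewrite -big_split mulr_sumr; apply: ler_sum => j _.
by rewrite -big_split mulr_sumr; apply: ler_sum => m _; exact: h.
Qed.

Lemma powR_expn (R : realType) (b : R) (k : nat) (a : R) : 0 <= b ->
  (b ^+ k) `^ a = (b `^ a) ^+ k.
Proof.
move=> b0; elim: k => [|k IH]; first by rewrite !expr0 powR1.
by rewrite !exprS powRM ?exprn_ge0// IH.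
Qed.

(** Restricts the double sum to finitely many pairs; [G] depends on [j] so that each shell can be
    paired with its own neighbour. *)
Lemma hardyR_ge_sum (R : realType) (d : nat) (B : set (lat d))
    (u : lat d -> R[i]) (p e r : R) (s : seq (lat d))
    (G : lat d -> seq (lat d)) :
  (hardyR B u p e <= r%:E)%E ->
  uniq s -> (forall j, j \in s -> B j) -> (forall j, uniq (G j)) ->
  (forall j m, j \in s -> m \in G j -> B m /\ m != j) ->
  \sum_(j <- s) \sum_(m <- G j)
     cabs (u j - u m) `^ p / (supn (latsub j m))%:R `^ e <= r.
Proof.
move=> hr us sB uG GB; rewrite -lee_fin; apply: le_trans hr.
apply: le_trans (sum_le_esum _ us sB); rewrite -sumEFin.
rewrite big_seq [leRHS]big_seq; apply: lee_sum => j js.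
rewrite -sumEFin; apply: sum_le_esum => // m mG.
by have [Bm /eqP mj] := GB _ _ js mG; split.
Qed.

(** * Passage from a shell to its neighbour *)

(** The exponent a + d is split. Since D <= 2 b b^k, the factor D^a is of order b^(ka). The factor
    D^d is at most the volume of the ball containing both shells, which [kappa] compares with the
    size of the target shell. *)
Lemma dist_weight (R : realType) (d : nat) (full : bool) (b k l kappa : nat)
    (a : R) (j m : lat d) :
  (0 < d)%N -> (1 < b)%N -> 0 < a -> (l <= k.+1)%N ->
  (vol d full b (maxn k l) <= kappa * vol d full b l)%N ->
  j \in shell d full b k -> m \in shell d full b l ->
  (supn (latsub j m))%:R `^ (a + d%:R) <=
  (2 * b%:R) `^ a * (2 * kappa%:R) * (b%:R `^ a) ^+ k *
  (size (shell d full b l))%:R.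
Proof.
move=> d0 b1 a0 lk hvol jk ml; have b0 := ltnW b1.
have b'0 n : (0 < b ^ n)%N by rewrite expn_gt0 b0.
have inball n x : (n <= maxn k l)%N -> x \in shell d full b n ->
    x \in ball d full (b ^ maxn k l).-1.
  move=> nkl /shell_ball; apply: ball_sub.
  by have := leq_pexp2l b0 nkl; have := b'0 n; lia.
have jb := inball _ _ (leq_maxl k l) jk.
have mb := inball _ _ (leq_maxr k l) ml.
have Dw := ball_dist jb mb; set D := supn _ in Dw *.
have Dvol : (D ^ d <= 2 * kappa * size (shell d full b l))%N.
  apply: (@leq_trans (vol d full b (maxn k l))).
    by rewrite /vol leq_exp2r// ltnW.
  apply: (leq_trans hvol); rewrite -mulnA mulnCA leq_mul2l size_shell_lb//.
  by rewrite orbT.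
have Db : (D <= 2 * b * b ^ k)%N.
  rewrite -mulnA -expnS; have : (b ^ maxn k l <= b ^ k.+1)%N.
    by rewrite leq_pexp2l// geq_max leqnSn.
  have := b'0 (maxn k l); move: Dw; rewrite /width.
  by case: full {inball ml jk jb mb hvol Dvol}; lia.
rewrite powRD; last first.
  by rewrite gt_eqF// ltr_wpDr.
rewrite powR_mulrn// [leRHS](_ : _ =
  ((2 * b%:R) `^ a * (b%:R `^ a) ^+ k) *
  (2 * kappa%:R * (size (shell d full b l))%:R)); last by ring.
apply: ler_pM.
- exact: powR_ge0.
- by rewrite exprn_ge0.
- rewrite -powR_expn// -powRM ?mulr_ge0 ?exprn_ge0//.
  apply: ge0_ler_powR; rewrite ?nnegrE ?mulr_ge0 ?exprn_ge0 ?ler0n ?(ltW a0)//.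
  by rewrite -natrX -!natrM ler_nat.
- by rewrite -[D%:R ^+ d]natrX -!natrM ler_nat.
Qed.

(** Common core of both regimes, with [l k] the neighbour of [k]. The ratio hypothesis carries an
    extra factor 2 precisely so that the remainder gets the coefficient 1/2. *)
Lemma shells_average (R : realType) (d : nat) (full : bool)
    (b kappa K : nat) (p a r : R) (B : set (lat d)) (l : nat -> nat)
    (u : lat d -> R[i]) :
  (0 < d)%N -> (1 < b)%N -> 0 < p -> 0 < a ->
  (forall k, (0 < k)%N -> (l k <= k.+1)%N /\ l k != k) ->
  (forall k, (0 < k)%N ->
     (vol d full b (maxn k (l k)) <= kappa * vol d full b (l k))%N) ->
  (forall k, (0 < k)%N ->
     2 * 2 `^ p * (size (shell d full b k))%:R * (b%:R `^ a) ^- k <=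
     (size (shell d full b (l k)))%:R * (b%:R `^ a) ^- l k) ->
  (forall k j, (0 < k)%N -> j \in shell d full b k -> B j) ->
  (forall k j, (0 < k)%N -> j \in shell d full b (l k) -> B j) ->
  (hardyR B u p (a + d%:R) <= r%:E)%E ->
  \sum_(1 <= k < K.+1)
     (b%:R `^ a) ^- k * (\sum_(j <- shell d full b k) cabs (u j) `^ p) <=
  2 `^ p * ((2 * b%:R) `^ a * (2 * kappa%:R)) * r +
  2^-1 * \sum_(1 <= k < K.+1)
     (b%:R `^ a) ^- l k * (\sum_(j <- shell d full b (l k)) cabs (u j) `^ p).
Proof.
move=> d0 b1 p0 a0 hl hvol hratio BT BTl hr; have b0 := ltnW b1.
set q := b%:R `^ a; have q0 : 0 < q by rewrite powR_gt0// ltr0n.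
set C := _ * (2 * kappa%:R).
have C0 : 0 <= C by rewrite mulr_ge0 ?powR_ge0 ?mulr_ge0.
pose T := shell d full b.
pose h j m := cabs (u j - u m) `^ p / (supn (latsub j m))%:R `^ (a + d%:R).
have energy : \sum_(1 <= k < K.+1) \sum_(j <- T k) \sum_(m <- T (l k)) h j m <= r.
  (* The sum over [k] becomes a sum over points, with the target shell read off from [level], as
     [hardyR_ge_sum] requires. *)
  have -> : \sum_(1 <= k < K.+1) \sum_(j <- T k) \sum_(m <- T (l k)) h j m =
      \sum_(j <- shells d full b K) \sum_(m <- T (l (level b j))) h j m.
    rewrite big_shells; apply: eq_bigr => k _; rewrite big_seq [RHS]big_seq.
    by apply: eq_bigr => j /(shell_level b1) ->.
  apply: (hardyR_ge_sum (G := fun j => T (l (level b j))) hr).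
  - exact: shells_uniq.
  - by move=> j /mem_shells[k /andP[k0 _]]; exact: BT.
  - by move=> j; exact: shell_uniq.
  - move=> j m /mem_shells[k /andP[k0 _] jk]; rewrite (shell_level b1 jk) => mlk.
    split; first exact: BTl mlk.
    apply/eqP => mj; have [_ /eqP] := hl _ k0; apply.
    by rewrite -(shell_level b1 mlk) mj (shell_level b1 jk).
apply: (@le_trans _ _ (\sum_(1 <= k < K.+1)
   (2 `^ p * C * (\sum_(j <- T k) \sum_(m <- T (l k)) h j m) +
    2^-1 * (q ^- l k * \sum_(j <- T (l k)) cabs (u j) `^ p)))); last first.
  rewrite big_split -!mulr_sumr lerD2r ler_wpM2l// mulr_ge0 ?powR_ge0//.
rewrite big_nat_cond [leRHS]big_nat_cond; apply: ler_sum => k.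
rewrite andbT => /andP[k0 _].
have [lk lkk] := hl _ k0.
have N0 : (0 < size (T (l k)))%N.
  have := size_shell_lb full (l k) d0 b1.
  have : (0 < vol d full b (l k))%N by rewrite /vol expn_gt0.
  by rewrite -/(T _); lia.
have := @sum_average R _ (T k) (T (l k)) (fun j => cabs (u j) `^ p)
   (fun j m => cabs (u j - u m) `^ p) (2 `^ p)
   (fun j m => powR_cabs_le (u j) (u m) (ltW p0)).
set A := \sum_(j <- T k) cabs (u j) `^ p.
set A' := \sum_(m <- T (l k)) cabs (u m) `^ p.
set E := \sum_(j <- T k) \sum_(m <- T (l k)) cabs (u j - u m) `^ p => avg.
(* The factor q^k in [dist_weight] cancels the weight q^(-k); the factor left over is the size by
   which the average divides. *)
have EC : q ^- k * E <=
   C * (size (T (l k)))%:R * \sum_(j <- T k) \sum_(m <- T (l k)) h j m.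
  rewrite /E !mulr_sumr [leLHS]big_seq [leRHS]big_seq; apply: ler_sum => j jk.
  rewrite !mulr_sumr [leLHS]big_seq [leRHS]big_seq; apply: ler_sum => m ml.
  have mj : m != j.
    apply/eqP => mj; move/eqP: lkk; apply.
    by rewrite -(shell_level b1 ml) mj (shell_level b1 jk).
  have D0 : 0 < (supn (latsub j m))%:R `^ (a + d%:R) :> R.
    by rewrite powR_gt0// ltr0n supn_latsub_gt0.
  have := dist_weight d0 b1 a0 lk (hvol _ k0) jk ml.
  rewrite -/q -/C -/(T _) => hD.
  rewrite [leLHS]mulrC [leRHS](_ : _ = cabs (u j - u m) `^ p *
    (C * (size (T (l k)))%:R / (supn (latsub j m))%:R `^ (a + d%:R))); last first.
    by rewrite /h; ring.
  apply: ler_wpM2l; first exact: powR_ge0.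
  rewrite ler_pdivlMr// mulrC ler_pdivrMr ?exprn_gt0//.
  by apply: (le_trans hD); rewrite mulrAC.
have A'0 : 0 <= A' by apply: sumr_ge0 => j _; rewrite powR_ge0.
have NR : 0 < (size (T (l k)))%:R :> R by rewrite ltr0n.
(* Instead of dividing by the size of the target shell, the goal is multiplied by it. It is then the
   sum of three inequalities: [avg] times q^(-k), [EC] times 2^p, and the ratio hypothesis times
   A'. *)
rewrite -(ler_pM2l NR).
have qk0 : 0 <= q ^- k by rewrite invr_ge0 exprn_ge0// ltW.
have := ler_wpM2r A'0 (hratio _ k0); rewrite -/(T _) -/(T _) -/q.
have := ler_wpM2l (powR_ge0 2 p) EC; have := ler_wpM2l qk0 avg.
move: (q ^- k) (q ^- l k) (2 `^ p) (\sum_(j <- T k) _).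
move: (size (T k))%:R (size (T (l k)))%:R => x1 x2 x3 x4 x5 x6.
lra.
Qed.

(** * Comparison of shell sums with the left side *)

(** The factor b^a is lost because |j| may be as small as b^(k-1) on the k-th shell. *)
Lemma hardyL_le_shells (R : realType) (d : nat) (full : bool) (b : nat)
    (p a c : R) (u : lat d -> R[i]) :
  (1 < b)%N -> 0 <= a ->
  (forall K, \sum_(1 <= k < K.+1)
     (b%:R `^ a) ^- k * (\sum_(j <- shell d full b k) cabs (u j) `^ p) <= c) ->
  (hardyL (dom d full) u p a <= (b%:R `^ a * c)%:E)%E.
Proof.
move=> b1 a0 hc; have b0 := ltnW b1.
have q0 : 0 < b%:R `^ a by rewrite powR_gt0// ltr0n.
pose g j := cabs (u j) `^ p / (supn j)%:R `^ a.
have g0 j : 0 <= g j by rewrite divr_ge0 ?powR_ge0.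
apply: esum_le_sum => s us sD; rewrite sumEFin lee_fin.
(* As n < b^n, the first K shells already contain all points of norm at most K other than the
   origin. *)
pose K := (\max_(j <- s) supn j)%N.
apply: (@le_trans _ _ (\sum_(j <- shells d full b K) g j)).
  apply: ler_sum_uniq_sub => // [|j js]; first exact: shells_uniq.
  have [jD /eqP j0] := sD _ js; apply/mem_shells.
  apply: shell_cover => //; apply: leq_ltn_trans (ltn_expl K b1).
  exact: leq_bigmax_seq.
rewrite big_shells; apply: le_trans (ler_wpM2l (ltW q0) (hc K)).
rewrite mulr_sumr big_nat_cond [leRHS]big_nat_cond; apply: ler_sum => -[|k]//= _.
rewrite !mulr_sumr [leLHS]big_seq [leRHS]big_seq; apply: ler_sum => j jk.
rewrite mulrA exprS invfM mulrA divff ?gt_eqF// mul1r mulrC.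
rewrite /g ler_wpM2l ?powR_ge0//.
have [_ /andP[kj _]] := (mem_shellS full k j b0).1 jk.
rewrite lef_pV2 ?posrE ?exprn_gt0//; last first.
  by rewrite powR_gt0// ltr0n supn_gt0 (shellS_neq0 b0 jk).
rewrite -powR_expn// -natrX.
by apply: ge0_ler_powR; rewrite ?nnegrE// ler_nat.
Qed.

Lemma shells_le_hardyL (R : realType) (d : nat) (full : bool) (b K : nat)
    (p a : R) (u : lat d -> R[i]) :
  (1 < b)%N -> 0 <= a ->
  ((\sum_(1 <= k < K.+1)
     (b%:R `^ a) ^- k * (\sum_(j <- shell d full b k) cabs (u j) `^ p))%:E
   <= hardyL (dom d full) u p a)%E.
Proof.
move=> b1 a0; have b0 := ltnW b1.
have q0 : 0 < b%:R `^ a by rewrite powR_gt0// ltr0n.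
apply: le_trans (sum_le_esum _ (shells_uniq d full K b1) _); last first.
  move=> j /mem_shells[[|k]// _ jk]; split; last first.
    by apply/eqP; exact: shellS_neq0 jk.
  by have [] := (mem_shellS full k j b0).1 jk.
rewrite sumEFin lee_fin big_shells.
rewrite big_nat_cond [leRHS]big_nat_cond; apply: ler_sum => -[|k]//= _.
rewrite !mulr_sumr [leLHS]big_seq [leRHS]big_seq; apply: ler_sum => j jk.
rewrite mulrC ler_wpM2l ?powR_ge0//.
have [_ /andP[_ kj]] := (mem_shellS full k j b0).1 jk.
rewrite lef_pV2 ?posrE ?exprn_gt0//; last first.
  by rewrite powR_gt0// ltr0n supn_gt0 (shellS_neq0 b0 jk).
rewrite -powR_expn// -natrX.
by apply: ge0_ler_powR; rewrite ?nnegrE// ler_nat ltnW.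
Qed.

(** * Absorption and reduction to real bounds *)

(** The supremum S is finite by boundedness and satisfies S <= c + S/2. Partial sums alone do not
    suffice, since going up a shell bounds the n-th one by the next. *)
Lemma bounded_contraction (R : realType) (x : nat -> R) (c M : R) :
  (forall n, x n <= M) -> (forall n, x n <= c + 2^-1 * x n.+1) ->
  forall n, x n <= 2 * c.
Proof.
move=> xM xc n.
have hS : has_sup (range x).
  by split; [exists (x 0%N); exists 0%N | exists M => _ [k _ <-]].
have xS k : x k <= sup (range x) by apply: ub_le_sup; [case: hS | exists k].
suff : sup (range x) <= c + 2^-1 * sup (range x).
  by have := xS n; lra.
apply: ge_sup; first by case: hS.
by move=> _ [k _ <-]; have := xc k; have := xS k.+1; lra.
Qed.

Lemma powR_natr_unbounded (R : realType) (M e : R) : 0 < e ->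
  exists2 b : nat, (1 < b)%N & M <= b%:R `^ e.
Proof.
(* One successor puts [b] above |M|^(1/e) after truncation, the other ensures b > 1. *)
move=> e0; pose b := (Num.truncn (`|M| `^ e^-1)).+2; exists b => //.
apply: (le_trans (ler_norm M)).
have -> : `|M| = (`|M| `^ e^-1) `^ e.
  by rewrite -powRrM mulVf ?gt_eqF// powRr1.
apply: ge0_ler_powR; rewrite ?nnegrE ?powR_ge0 ?ler0n ?(ltW e0)//.
apply: le_trans (ltW (truncnS_gt _)) _.
by rewrite ler_nat.
Qed.

Lemma hardyR_ge0 (R : realType) (d : nat) (B : set (lat d))
    (u : lat d -> R[i]) (p e : R) : (0 <= hardyR B u p e)%E.
Proof.
apply: esum_ge0 => j _; apply: esum_ge0 => m _.
by rewrite lee_fin divr_ge0 ?powR_ge0.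
Qed.

(** If the right side is infinite, so is its product with c > 0; only real bounds [r] remain to be
    treated. *)
Lemma hardyL_le_hardyR (R : realType) (d : nat) (A B : set (lat d))
    (u : lat d -> R[i]) (p a e c : R) : 0 < c ->
  (forall r, (hardyR B u p e <= r%:E)%E -> (hardyL A u p a <= (c * r)%:E)%E) ->
  (hardyL A u p a <= c%:E * hardyR B u p e)%E.
Proof.
move=> c0 h; have := hardyR_ge0 B u p e.
case hR : (hardyR B u p e) => [r| |]// _.
  by rewrite -EFinM; apply: h; rewrite hR.
by rewrite gt0_muley ?lte_fin// leey.
Qed.

(** * The two regimes and the conclusion *)

(** Here l k = k + 1, and kappa = 1 because the target shell has the larger ball. Given [b], the
    constant does not involve [d]. *)
Lemma hardy_subcritical (R : realType) (d : nat) (full : bool) (b : nat)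
    (p a : R) (u : lat d -> R[i]) :
  (0 < d)%N -> (1 < b)%N -> 0 < p -> 0 < a ->
  4 * 2 `^ p * b%:R `^ a <= b%:R ^+ d ->
  (hardyL (dom d full) u p a < +oo)%E ->
  (hardyL (dom d full) u p a <=
   (b%:R `^ a * (2 * (2 `^ p * ((2 * b%:R) `^ a * (2 * 1%:R)))))%:E *
   hardyR (dom d full `\ lat0 d) u p (a + d%:R))%E.
Proof.
move=> d0 b1 p0 a0 hb Lfin; have b0 := ltnW b1.
set q := b%:R `^ a; have q0 : 0 < q by rewrite powR_gt0// ltr0n.
apply: hardyL_le_hardyR.
  by rewrite !mulr_gt0 ?powR_gt0 ?mulr_gt0 ?ltr0n.
move=> r hr; rewrite -!mulrA; apply: hardyL_le_shells => //; first exact: ltW.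
have shellD k j : (0 < k)%N -> j \in shell d full b k ->
    (dom d full `\ lat0 d) j.
  case: k => // k _ jk; have [jD _] := (mem_shellS full k j b0).1 jk.
  by split => //; apply/eqP; exact: shellS_neq0 jk.
pose F k := q ^- k * \sum_(j <- shell d full b k) cabs (u j) `^ p.
have F0 k : 0 <= F k.
  by rewrite mulr_ge0 ?invr_ge0 ?exprn_ge0 ?(ltW q0) ?sumr_ge0// => j _;
    rewrite powR_ge0.
(* Finiteness of the left side enters here: it bounds all partial sums. *)
apply: (@bounded_contraction _ (fun K => \sum_(1 <= k < K.+1) F k) _
   (fine (hardyL (dom d full) u p a))).
  move=> K; rewrite -lee_fin fineK; first by apply: shells_le_hardyL => //; exact: ltW.
  rewrite ge0_fin_numE//; apply: esum_ge0 => j _.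
  by rewrite lee_fin divr_ge0 ?powR_ge0.
move=> K; have := @shells_average R d full b 1 K p a r
  (dom d full `\ lat0 d) S u d0 b1 p0 a0 _ _ _ shellD _ hr.
rewrite -/q => /(_ _ _ _ _)/le_trans -> //.
- by move=> k k0; rewrite leqnn gtn_eqF.
- by move=> k _; rewrite mul1n (maxn_idPr _).
- move=> k _; rewrite exprS invfM mulrA ler_wpM2r ?invr_ge0 ?exprn_ge0 ?(ltW q0)//.
  rewrite ler_pdivlMr//.
  have h1 : ((b ^ d * size (shell d full b k))%:R <=
             (2 * size (shell d full b k.+1))%:R :> R).
    rewrite ler_nat; apply: leq_trans (size_shell_lb full k.+1 d0 b1).
    apply: leq_trans (vol_lb d full k b0).
    by rewrite leq_mul2l size_shell_ub orbT.
  have h2 := ler_wpM2r (ler0n R (size (shell d full b k))) hb.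
  move: h1 h2; rewrite !natrM natrX -/q; move: (2 `^ p) => P; nra.
- by move=> k j _; exact: shellD.
(* The shifted sum is the sum up to K + 1 without its first, nonnegative term. *)
- rewrite -!mulrA lerD2l ler_wpM2l ?invr_ge0//.
  rewrite [leRHS]big_ltn// [X in _ <= _ + X]big_add1 /= lerDr.
  exact: F0.
Qed.

(** Here l k = k - 1, and kappa = (2b)^d by [vol_ub]. The descent ends at the origin, where u
    vanishes. *)
Lemma hardy_supercritical (R : realType) (d : nat) (full : bool) (b : nat)
    (p a : R) (u : lat d -> R[i]) :
  (0 < d)%N -> (1 < b)%N -> 0 < p -> 0 < a ->
  4 * 2 `^ p * (2 * b%:R) ^+ d <= b%:R `^ a ->
  u (lat0 d) = 0 ->
  (hardyL (dom d full) u p a <=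
   (b%:R `^ a *
    (2 * (2 `^ p * ((2 * b%:R) `^ a * (2 * ((2 * b) ^ d)%:R)))))%:E *
   hardyR (dom d full) u p (a + d%:R))%E.
Proof.
move=> d0 b1 p0 a0 hb u0; have b0 := ltnW b1.
set q := b%:R `^ a; have q0 : 0 < q by rewrite powR_gt0// ltr0n.
apply: hardyL_le_hardyR.
  by rewrite !mulr_gt0 ?powR_gt0 ?mulr_gt0 ?ltr0n ?expn_gt0 ?muln_gt0 ?b0.
move=> r hr; rewrite -!mulrA; apply: hardyL_le_shells => //; first exact: ltW.
have shellD k j : j \in shell d full b k -> dom d full j.
  by case/shell_ball/mem_ball.
pose F k := q ^- k * \sum_(j <- shell d full b k) cabs (u j) `^ p.
have F0 k : 0 <= F k.
  by rewrite mulr_ge0 ?invr_ge0 ?exprn_ge0 ?(ltW q0) ?sumr_ge0// => j _;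
    rewrite powR_ge0.
have F00 : F 0%N = 0.
  rewrite /F big_seq big1 ?mulr0// => j /shell0 ->.
  by rewrite u0 Normc.normc0 powR0// gt_eqF.
have hl k : (0 < k)%N -> (k.-1 <= k.+1)%N /\ k.-1 != k.
  by case: k => // k _; rewrite ltn_eqF//=; split => //; lia.
have hvol k : (0 < k)%N ->
    (vol d full b (maxn k k.-1) <= (2 * b) ^ d * vol d full b k.-1)%N.
  by case: k => // k _; rewrite (maxn_idPl _)//=; exact: vol_ub.
have hratio k : (0 < k)%N ->
    2 * 2 `^ p * (size (shell d full b k))%:R * q ^- k <=
    (size (shell d full b k.-1))%:R * q ^- k.-1.
  case: k => // k _ /=; rewrite exprS invfM mulrA.
  rewrite ler_wpM2r ?invr_ge0 ?exprn_ge0 ?(ltW q0)// ler_pdivrMr//.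
  have h1 : ((size (shell d full b k.+1))%:R <=
             ((2 * b) ^ d * (2 * size (shell d full b k)))%:R :> R).
    rewrite ler_nat; apply: leq_trans (size_shell_ub _ _ _ _) _.
    apply: leq_trans (vol_ub d full k b0) _.
    by rewrite leq_mul2l size_shell_lb// orbT.
  apply: le_trans (ler_wpM2l (ler0n R (size (shell d full b k))) hb).
  have P0 : 0 <= 2 * 2 `^ p :> R by rewrite mulr_ge0 ?powR_ge0.
  apply: le_trans (ler_wpM2l P0 h1) _.
  by rewrite !natrM natrX natrM le_eqVlt; apply/orP; left; apply/eqP; ring.
move=> K; have := @shells_average R d full b ((2 * b) ^ d) K p a r
  (dom d full) predn u d0 b1 p0 a0 hl hvol hratio
  (fun k j _ => shellD k j) (fun k j _ => shellD k.-1 j) hr.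
rewrite -/q.
(* Shifting down brings in only F 0 = 0 and drops F K, so the remainder is absorbed within a single
   finite sum. *)
have : \sum_(1 <= k < K.+1) F k.-1 <= \sum_(1 <= k < K.+1) F k.
  rewrite big_add1 /=; case: K => [|K]; first by rewrite !big_geq.
  rewrite big_nat_recl// F00 add0r [leRHS]big_add1 /= big_nat_recr//=.
  by rewrite lerDl.
rewrite /F; move: (\sum_(1 <= k < K.+1) _) => Y.
move: (\sum_(1 <= k < K.+1) _) => X; lra.
Qed.

(* full = false : the lattice Z_+^d ; full = true : the lattice Z^d (part 4) *)
Theorem theorem1p2 (R : realType) (s p : R) (hs : 0 < s) (hp : 0 < p) :
  (* (1) sp < d, d - sp >= delta > 0 ; constant depends only on s, p, delta *)
  (forall (full : bool) (delta : R), 0 < delta ->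
     exists c : R, 0 < c /\
       forall (d : nat), (0 < d)%N -> s * p < d%:R -> delta <= d%:R - s * p ->
       forall u : lat d -> R[i],
         (hardyL (dom d full) u p (s * p) < +oo)%E ->
         (hardyL (dom d full) u p (s * p)
            <= c%:E * hardyR (dom d full `\ lat0 d) u p (s * p + d%:R))%E)
  /\
  (* (2) sp = d ; constant depends on d, s, p, eps *)
  (forall (full : bool) (d : nat) (eps : R), (0 < d)%N -> s * p = d%:R -> 0 < eps ->
     exists c : R, 0 < c /\
       forall u : lat d -> R[i], u (lat0 d) = 0 ->
         (hardyL (dom d full) u p (s * p + eps)
            <= c%:E * hardyR (dom d full) u p (s * p + d%:R + eps))%E /\
         (c%:E * hardyR (dom d full) u p (s * p + d%:R + eps)
            <= c%:E * hardyR (dom d full) u p (s * p + d%:R))%E)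
  /\
  (* (3) sp > d ; constant depends on d, s, p *)
  (forall (full : bool) (d : nat), (0 < d)%N -> d%:R < s * p ->
     exists c : R, 0 < c /\
       forall u : lat d -> R[i], u (lat0 d) = 0 ->
         (hardyL (dom d full) u p (s * p)
            <= c%:E * hardyR (dom d full) u p (s * p + d%:R))%E).
Proof.
(* Serves both sp > d, with a = sp, and sp = d, with a = sp + eps. *)
have super (full : bool) (d : nat) (a : R) : (0 < d)%N -> d%:R < a ->
    exists c : R, 0 < c /\ forall u : lat d -> R[i], u (lat0 d) = 0 ->
      (hardyL (dom d full) u p a <=
         c%:E * hardyR (dom d full) u p (a + d%:R))%E.
  move=> d0 da; have da0 : 0 < a - d%:R by rewrite subr_gt0.
  (* This is the smallness condition of [hardy_supercritical] divided by b^d. *)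
  have [b b1 hb] := powR_natr_unbounded (4 * 2 `^ p * 2 ^+ d) da0.
  have b0 : 0 < b%:R :> R by rewrite ltr0n ltnW.
  have a0 : 0 < a by apply: le_lt_trans da.
  eexists; split; last first.
    move=> u u0; apply: (hardy_supercritical _ d0 b1 hp a0 _ u0).
    rewrite exprMn mulrA -ler_pdivlMr ?exprn_gt0//; apply: (le_trans hb).
    by rewrite -powR_mulrn ?(ltW b0)// powRB// (gt_eqF b0) implybT.
  by rewrite !mulr_gt0 ?powR_gt0 ?mulr_gt0 ?ltr0n ?expn_gt0 ?muln_gt0 ?(ltnW b1).
split; last split.
- move=> full delta delta0.
  (* [b] is fixed before [d] is introduced, which makes the constant uniform in the dimension; b^(d
     - sp) >= b^delta then gives the required condition. *)
  have [b b1 hb] := powR_natr_unbounded (4 * 2 `^ p) delta0.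
  have b0 : 0 < b%:R :> R by rewrite ltr0n ltnW.
  eexists; split; last first.
    move=> d d0 spd hdelta u Lfin.
    apply: (hardy_subcritical d0 b1 hp (mulr_gt0 hs hp) _ Lfin).
    rewrite -ler_pdivlMr ?powR_gt0//; apply: (le_trans hb).
    rewrite -powR_mulrn ?(ltW b0)// -powRB ?(gt_eqF b0) ?implybT//.
    by apply: ler_powR => //; rewrite ler1n ltnW.
  by rewrite !mulr_gt0 ?powR_gt0 ?mulr_gt0 ?ltr0n ?(ltnW b1).
- move=> full d eps d0 spd eps0.
  have [|c [c0 hc]] := super full d (s * p + eps) d0; first by rewrite spd ltrDl.
  exists c; split => // u u0; split; first by rewrite addrAC; exact: hc.
  apply: lee_wpmul2l; first by rewrite lee_fin ltW.
  apply: le_esum => j _; apply: le_esum => m [_ /eqP mj].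
  (* Distinct lattice points are at distance at least 1, so a larger exponent only decreases the
     term. *)
  have D0 : (0 < supn (latsub j m))%N by rewrite supn_latsub_gt0.
  rewrite lee_fin ler_wpM2l ?powR_ge0// lef_pV2 ?posrE ?powR_gt0 ?ltr0n//.
  by apply: ler_powR; rewrite ?ler1n// lerDl ltW.
- by move=> full d d0 dsp; exact: super.
Qed.
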